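(* Let $V=(V_1,\dots,V_n)$ be an $n$-tuple of isometries on a Hilbert space $\mathcal H$ satisfying $$V_jV_i=z_{ji}V_iV_j,\qquad V_i^*V_j=\overline{z_{ij}}\,V_jV_i^*\qquad(i\ne j),$$ for scalars $z_{ij}\in\mathbb T$ with $z_{ij}z_{ji}=1$ and $z_{ii}=1$. Then $V$ admits a unitary extension.
   Context: $\mathbb T$ is the unit circle in $\mathbb C$. A unitary extension of $V$ is an $n$-tuple of unitaries $(\widehat V_1,\dots,\widehat V_n)$ on a Hilbert space $\mathcal K$ containing $\mathcal H$ (isometrically) such that $\widehat V_i|_{\mathcal H}=V_i$ for all $i$ and the $\widehat V_i$ satisfy the same relations: $\widehat V_j\widehat V_i=z_{ji}\widehat V_i\widehat V_j$ and $\widehat V_i^*\widehat V_j=\overline{z_{ij}}\,\widehat V_j\widehat V_i^*$ for $i\neq j$. *)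

(* Defs.v *)
From HB Require Import structures.
From mathcomp Require Import all_boot all_order all_algebra.
From mathcomp Require Import complex lra.
From mathcomp Require Import all_classical all_reals all_analysis.

Set Implicit Arguments.
Unset Strict Implicit.
Unset Printing Implicit Defensive.

Import Order.TTheory GRing.Theory Num.Theory.
Import numFieldNormedType.Exports.

Local Open Scope classical_set_scope.
Local Open Scope ring_scope.

(* The inner product is linear in its first argument. *)
HB.mixin Record CompleteNormedModule_isHilbert (R : realType) H
    & CompleteNormedModule R[i] H := {
  inner : H -> H -> R[i];
  innerP : forall (a : R[i]) (x y z : H),
    inner (a *: x + y) z = a * inner x z + inner y z;
  innerC : forall x y : H, inner y x = (inner x y)^*;
  inner_norm : forall x : H, inner x x = `|x| ^+ 2
}.

#[short(type="hilbertType")]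
HB.structure Definition Hilbert (R : realType) :=
  {H of CompleteNormedModule R[i] H & CompleteNormedModule_isHilbert R H}.

Section Adjoint.
Variable R : realType.
Implicit Types H K : hilbertType R.

(* Meaningful for bounded linear [T], where [adjointP] applies. *)
Definition adjoint H K (T : H -> K) (y : K) : H :=
  get [set z | forall x, inner (T x) y = inner x z].

Lemma innerDl H (x y z : H) : inner (x + y) z = inner x z + inner y z.
Proof. by rewrite -{1}[x]scale1r innerP mul1r. Qed.

Lemma inner0l H (z : H) : inner 0 z = 0 :> R[i].
Proof. by apply: (addrI (inner 0 z)); rewrite -innerDl !addr0. Qed.

Lemma innerZl H a (x z : H) : inner (a *: x) z = a * inner x z.
Proof. by rewrite -[a *: x]addr0 innerP inner0l addr0. Qed.

Lemma innerDr H (x y z : H) : inner x (y + z) = inner x y + inner x z.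
Proof. by rewrite innerC innerDl rmorphD /= -!innerC. Qed.

Lemma innerZr H a (x z : H) : inner x (a *: z) = a^* * inner x z.
Proof. by rewrite innerC innerZl rmorphM /= -innerC. Qed.

Lemma inner_inj H (y z : H) : (forall x, inner x y = inner x z) -> y = z.
Proof.
move=> yz; apply/eqP; rewrite -subr_eq0 -normr_eq0 -sqrf_eq0 -inner_norm.
by rewrite -scaleN1r innerDr innerZr -yz -innerZr -innerDr !scaleN1r subrr
  innerC inner0l rmorph0.
Qed.

Let N H (x : H) : R := complex.Re (inner x x).

Let ReD (a b : R[i]) : complex.Re (a + b) = complex.Re a + complex.Re b.
Proof. by case: a; case: b. Qed.

Let ReZ (t : R) (a : R[i]) : complex.Re (t%:C%C * a) = t * complex.Re a.
Proof. by case: a => a b /=; rewrite mul0r subr0. Qed.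

Let ReC (a : R[i]) : complex.Re a^* = complex.Re a.
Proof. by case: a. Qed.

Let norm_Re H (x : H) : `|x| = (complex.Re `|x|)%:C%C :> R[i].
Proof. by rewrite RRe_real ?normr_real. Qed.

Let N_norm H (x : H) : N x = complex.Re `|x| ^+ 2.
Proof. by rewrite /N inner_norm norm_Re -rmorphXn. Qed.

Let N_ge0 H (x : H) : 0 <= N x. Proof. by rewrite N_norm sqr_ge0. Qed.

Let ND H (t : R) (x y : H) :
  N (t%:C%C *: x + y) = t ^+ 2 * N x + N y + 2 * t * complex.Re (inner x y).
Proof.
rewrite /N innerDl !innerDr !innerZl !innerZr !ReD ReZ.
have -> : (t%:C%C)^* = t%:C%C :> R[i] by apply: conjc_real.
rewrite !ReZ (innerC x y) ReC; lra.
Qed.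

Lemma cauchy_schwarz H (x y : H) : `|inner x y| <= `|x| * `|y| :> R[i].
Proof.
have re (u v : H) : (complex.Re (inner u v))%:C%C <= `|u| * `|v| :> R[i].
  have [->|u0] := eqVneq u 0; first by rewrite inner0l normr0 mul0r.
  have [->|v0] := eqVneq v 0.
    by rewrite innerC inner0l rmorph0 normr0 mulr0.
  rewrite (norm_Re u) (norm_Re v) -rmorphM lecR /=.
  set a := complex.Re `|u|; set b := complex.Re `|v|.
  have a0 : 0 < a by rewrite -ltcR -norm_Re normr_gt0.
  have b0 : 0 < b by rewrite -ltcR -norm_Re normr_gt0.
  have := N_ge0 ((- (b / a))%:C%C *: u + v).
  rewrite ND !N_norm -/a -/b sqrrN exprMn exprVn divfK ?expf_neq0 ?gt_eqF //.
  set c := complex.Re _ => h.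
  have : b / a * c <= b / a * (a * b).
    by rewrite mulrA divfK ?gt_eqF //; move: (b / a) h => s h; lra.
  by rewrite ler_pM2l // divr_gt0.
have [->|c0] := eqVneq (inner x y) 0; first by rewrite normr0 mulr_ge0.
have := re ((inner x y)^* *: x) y.
rewrite innerZl mulrC -normCK normrZ norm_conjC RRe_real ?realX ?normr_real //.
by rewrite expr2 -mulrA ler_pM2l // normr_gt0.
Qed.

Let step_bound (d s a L X p g h v w : R) : 0 < s ->
  d <= (- s) ^+ 2 * h + v + 2 * - s * X - 2 * (- s * p + g) ->
  d <= s ^+ 2 * h + v + 2 * s * X - 2 * (s * p + g) ->
  0 <= (- s) ^+ 2 * h + w + 2 * - s * (X - L) ->
  0 <= s ^+ 2 * h + w + 2 * s * (X - L) ->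
  v - 2 * g < d + a ->
  a + w < 2 * s ^+ 2 ->
  `|L - p| <= s * (h + 1).
Proof.
move=> s0; rewrite sqrrN => A1 A2 B1 B2 un nP.
rewrite ler_norml -(ler_pM2l s0) -[X in _ && X](ler_pM2l s0).
rewrite mulrN !mulrA -expr2 mulrDr mulr1.
move: (s ^+ 2) A1 A2 B1 B2 nP => t A1 A2 B1 B2 nP.
apply/andP; split; lra.
Qed.

Lemma riesz H (f : H -> R[i]) (M : R) :
    (forall a x y, f (a *: x + y) = a * f x + f y) ->
    (forall x, `|f x| <= M%:C%C * `|x|) ->
  exists z, forall x, f x = inner x z.
Proof.
move=> flin fM.
have f0 : f 0 = 0.
  have e := flin 1 0 0; rewrite scale1r addr0 mul1r in e.
  by apply: (addrI (f 0)); rewrite -e addr0.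
have fRe (t : R) x y :
    complex.Re (f (t%:C%C *: x + y)) = t * complex.Re (f x) + complex.Re (f y).
  by rewrite flin ReD ReZ.
pose F x : R := N x - 2 * complex.Re (f x).
have Fpar x y : exists w, N (x - y) = 2 * F x + 2 * F y - 4 * F w.
  exists ((2^-1)%:C%C *: (y + (-1)%:C%C *: (- x))).
  have e0 : (-1)%:C%C *: (- x) = x :> H.
    by rewrite (_ : (-1)%:C%C = -1) ?scaleN1r ?opprK // rmorphN1.
  rewrite e0.
  have -> : x - y = (-1)%:C%C *: y + x.
    by rewrite (_ : (-1)%:C%C = -1) ?scaleN1r 1?addrC // rmorphN1.
  have -> : (2^-1)%:C%C *: (y + x) = (2^-1)%:C%C *: (1%:C%C *: y + x) + 0.
    by rewrite addr0 scale1r.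
  have i0 (v : H) : inner v 0 = 0 :> R[i] by rewrite innerC inner0l rmorph0.
  have N0 : N (0 : H) = 0 by rewrite /N i0.
  by rewrite /F !ND !fRe f0 N0 i0 /=; lra.
have Fbd x : - M ^+ 2 <= F x.
  have := fM x; rewrite norm_Re -rmorphM /= => fMx.
  have : `|complex.Re (f x)| <= M * complex.Re `|x|.
    by rewrite -lecR; apply: le_trans fMx; exact: normc_ge_Re.
  rewrite ler_norml => /andP[_ le]; rewrite /F N_norm.
  have := sqr_ge0 (complex.Re `|x| - M); nra.
pose d := inf (range F).
have hF : has_inf (range F).
  split; first by exists (F 0), 0.
  by exists (- M ^+ 2) => _ [x _ <-].
have dF x : d <= F x by apply: ge_inf; [case: hF|exists x].
have /choice[u uF] : forall n : nat, exists x, F x < d + n.+1%:R^-1.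
  move=> n; have [|_ [x _ <-] lt] := @inf_adherent _ (range F) n.+1%:R^-1 _ hF.
    by rewrite invr_gt0.
  by exists x.
have uC n m : N (u n - u m) <= 2 * n.+1%:R^-1 + 2 * m.+1%:R^-1.
  have [w ->] := Fpar (u n) (u m).
  have := dF w; have := uF n; have := uF m.
  move: (_^-1) (_^-1) => a b; lra.
have arch (e : R) : 0 < e -> exists n : nat, forall m, (n <= m)%N -> m.+1%:R^-1 < e.
  move=> e0; have [n _ nP] := near_infty_natSinv_lt (PosNum e0).
  by exists n => m nm; apply: nP.
have ucvg : cvg (u @ \oo).
  apply/cauchy_cvgP/cauchy_exP => e e0.
  have e1 : 0 < complex.Re e by move: e0; rewrite ltcE /= => /andP[_].
  have eE : e = (complex.Re e)%:C%C by rewrite RRe_real ?gtr0_real.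
  have [n nP] := arch (complex.Re e ^+ 2 / 4) ltac:(by rewrite divr_gt0 ?exprn_gt0).
  exists (u n), n => // m /= nm; rewrite -ball_normE /= norm_Re eE ltcR.
  rewrite -(@ltr_pXn2r _ 2) ?nnegrE ?(ltW e1) //; last first.
    by rewrite -lecR -norm_Re normr_ge0.
  rewrite -N_norm; have := uC n m; have := nP _ nm; have := nP _ (leqnn n).
  move: (n.+1%:R^-1) (m.+1%:R^-1) => a b; lra.
pose l := lim (u @ \oo).
have ul (e : R) : 0 < e -> exists n : nat, n.+1%:R^-1 + N (u n - l) < e.
  move=> e0; have [n nP] := arch (e / 2) ltac:(by rewrite divr_gt0).
  have s0 : 0 < Num.sqrt (e / 2) by rewrite sqrtr_gt0 divr_gt0.
  have /cvgrPdist_lt/(_ (Num.sqrt (e / 2))%:C%C) : u @ \oo --> l by [].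
  rewrite ltcR => /(_ s0) [n' _ nP']; exists (maxn n n').
  have := nP' _ (leq_maxr n n'); rewrite /= distrC norm_Re ltcR => lt.
  have : N (u (maxn n n') - l) < e / 2.
    rewrite N_norm -(@sqr_sqrtr _ (e / 2)) ?ltW ?divr_gt0 //.
    by rewrite ltr_pXn2r // nnegrE ?(ltW s0) // -lecR -norm_Re normr_ge0.
  have := nP _ (leq_maxl n n').
  move: ((maxn n n').+1%:R^-1) => a; lra.
have key h : complex.Re (inner h l) = complex.Re (f h).
  apply/eqP; rewrite -subr_eq0 -normr_le0.
  set c := _ - _.
  have step (s : R) : 0 < s -> `|c| <= s * (N h + 1).
    move=> s0; have [n nP] := ul (2 * s ^+ 2) ltac:(by rewrite mulr_gt0 ?exprn_gt0).
    have A (t : R) := dF (t%:C%C *: h + u n).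
    have B (t : R) := N_ge0 (t%:C%C *: h + (u n - l)).
    have Nl : complex.Re (inner h (u n - l))
        = complex.Re (inner h (u n)) - complex.Re (inner h l).
      have -> : inner h (u n) = inner h ((u n - l) + l) by rewrite subrK.
      by rewrite (innerDr h (u n - l)) ReD addrK.
    have := B s; have := B (- s); have := A s; have := A (- s).
    rewrite /F !fRe !ND Nl => A1 A2 B1 B2; have := uF n; rewrite /F => un.
    exact: (step_bound s0 A1 A2 B1 B2 un nP).
  have N1 : 0 < N h + 1 by rewrite ltr_wpDl ?N_ge0.
  rewrite leNgt; apply/negP => c0.
  have := step (`|c| / (N h + 1) / 2) ltac:(by rewrite !divr_gt0).
  by rewrite mulrAC divfK ?gt_eqF //; lra.
exists l => x; apply/eqP; rewrite eq_complex key eqxx /=.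
have fZ : f ('i%C *: x) = 'i%C * f x.
  by rewrite -[_ *: x]addr0 flin f0 addr0.
have := key ('i%C *: x); rewrite innerZl fZ !(mulrC 'i%C) !ReiNIm.
by move=> /oppr_inj ->.
Qed.

Lemma adjointP H K (T : {linear H -> K}) :
  continuous T -> forall x y, inner (T x) y = inner x (adjoint T y).
Proof.
move=> /linear_bounded_continuous/linear_boundedP/pinfty_ex_gt0[M M0 TM] x y.
have [z zP] : exists z, forall x, inner (T x) y = inner x z.
  apply: (@riesz _ _ (complex.Re (M * `|y|))) => [a u v|u].
    by rewrite linearP innerP.
  rewrite RRe_real ?(realM (gtr0_real M0)) ?normr_real //.
  apply: le_trans (cauchy_schwarz _ _) _.
  by rewrite mulrAC ler_wpM2r.
have aP : [set w | forall x, inner (T x) y = inner x w] (adjoint T y).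
  by apply: getPex; exists z.
exact: aP.
Qed.

End Adjoint.

Section UnitaryExtension.
Variable R : realType.
Implicit Types H K : hilbertType R.

Definition is_isometry H K (T : H -> K) := forall x, `|T x| = `|x| :> R[i].

Definition unitary K (U : {linear K -> K}) :=
  [/\ continuous U, forall x, adjoint U (U x) = x
    & forall x, U (adjoint U x) = x].

Definition twisted_relations n (z : 'I_n -> 'I_n -> R[i]) H
    (V : 'I_n -> {linear H -> H}) :=
  forall i j, i != j ->
    (forall x, V j (V i x) = z j i *: V i (V j x)) /\
    (forall x, adjoint (V i) (V j x) = (z i j)^* *: V j (adjoint (V i) x)).

(* [iota] realizes the containment of [H] in [K]. *)
Definition unitary_extension n (z : 'I_n -> 'I_n -> R[i]) H
    (V : 'I_n -> {linear H -> H}) K (iota : {linear H -> K})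
    (U : 'I_n -> {linear K -> K}) :=
  [/\ is_isometry iota, forall i, unitary (U i),
      forall i x, U i (iota x) = iota (V i x)
    & twisted_relations z U].

End UnitaryExtension.

(* Main.v *)
(* Let T be the product of the V_i.  It is an isometry with V_j T = c_j T V_j
   and T = V_j Q_j, so making T invertible makes every V_j invertible.  The
   minimal unitary extension of T lives on the space K of bounded sequences
   (x_m) in H with T^* x_{m+1} = x_m, normed by sup |x_m| = lim |x_m|: here x_m
   stands for the projection to H of the m-th power of the extension applied to
   x.  In this model the adjoints of the extensions are
   (S_j x)_m = c_j^m V_j^* x_m, and the extensions are their inverses
   (U_j x)_m = c_j^{-(m+1)} Q_j^* x_{m+1}.  Both are contractions, hence
   unitary, and for unitaries the adjoint relation follows from the commutation
   relation. *)
From HB Require Import structures.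
Require Import Defs.
From mathcomp Require Import all_boot all_order all_algebra.
From mathcomp Require Import complex lra.
From mathcomp Require Import all_classical all_reals all_analysis.

Set Implicit Arguments.
Unset Strict Implicit.
Unset Printing Implicit Defensive.

Import Order.TTheory GRing.Theory Num.Theory.
Import numFieldNormedType.Exports.

Local Open Scope classical_set_scope.
Local Open Scope ring_scope.

(** * Real-valued norms *)

Section RealNorm.
Variables (R : realType) (W : normedModType R[i]).
Implicit Types x y : W.

Definition rnorm x : R := complex.Re `|x|.

Lemma rnormE x : `|x| = (rnorm x)%:C%C.
Proof. by rewrite /rnorm RRe_real ?normr_real. Qed.

Lemma rnorm_ge0 x : 0 <= rnorm x.
Proof. by rewrite -lecR -rnormE normr_ge0. Qed.

Lemma rnorm0 : rnorm 0 = 0.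
Proof. by rewrite /rnorm normr0. Qed.

Lemma rnormD x y : rnorm (x + y) <= rnorm x + rnorm y.
Proof. by rewrite -lecR rmorphD /= -!rnormE ler_normD. Qed.

Lemma rnormZ (a : R[i]) x : rnorm (a *: x) = complex.Re `|a| * rnorm x.
Proof.
have := normrZ a x.
by rewrite -(RRe_real (normr_real a)) !rnormE -rmorphM => -[].
Qed.

End RealNorm.

(** * Polarization, isometries, adjoints and unitaries *)

Section Inner.
Variable R : realType.
Implicit Types H K : hilbertType R.

Lemma Re_inner_diag H (x : H) : complex.Re (inner x x) = rnorm x ^+ 2.
Proof. by rewrite inner_norm rnormE -rmorphXn. Qed.

Lemma ReD (a b : R[i]) : complex.Re (a + b) = complex.Re a + complex.Re b.
Proof. by case: a; case: b. Qed.

(** Expresses inner products through norms, so that isometries preserve them and convergence of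
    norms yields convergence of inner products; [Im_inner] reduces imaginary parts to this case. *)
Lemma Re_inner_polar H (x y : H) :
  complex.Re (inner x y) =
  2^-1 * (rnorm (x + y) ^+ 2 - rnorm x ^+ 2 - rnorm y ^+ 2).
Proof.
rewrite -!Re_inner_diag innerDl !innerDr !ReD (innerC x y).
have -> : complex.Re (inner x y)^* = complex.Re (inner x y) by case: inner.
lra.
Qed.

Lemma Im_inner H (x y : H) :
  complex.Im (inner x y) = complex.Re (inner x ('i%C *: y)).
Proof. by rewrite innerZr; case: inner => a b /=; lra. Qed.

Lemma contraction_continuous (V W : normedModType R[i]) (T : {linear V -> W}) :
  (forall x, `|T x| <= `|x|) -> continuous T.
Proof.
move=> T1; apply/linear_bounded_continuous/linear_boundedP.
exists 1; split => [|M M1 x]; first exact: real1.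
by apply: le_trans (T1 x) _; rewrite ler_peMl // ltW.
Qed.

Lemma isometry_continuous H K (T : {linear H -> K}) :
  is_isometry T -> continuous T.
Proof. by move=> T1; apply: contraction_continuous => x; rewrite T1. Qed.

Lemma isometry_inner H K (T : {linear H -> K}) x y :
  is_isometry T -> inner (T x) (T y) = inner x y.
Proof.
move=> T1; have T1' u : rnorm (T u) = rnorm u by rewrite /rnorm T1.
apply/eqP; rewrite eq_complex !Im_inner -linearZ !Re_inner_polar -!linearD.
by rewrite !T1' !eqxx.
Qed.

Lemma linear_from (V W : lmodType R[i]) (f : V -> W) :
  linear f -> exists g : {linear V -> W}, g =1 f.
Proof.
move=> flin.
pose g : {linear V -> W} :=
  HB.pack f (GRing.isLinear.Build R[i] V W *:%R f flin).
by exists g.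
Qed.

(** Contractivity is Cauchy-Schwarz applied to [|A y|^2 = inner (T (A y)) y], since [T] preserves
    the norm of [A y]. *)
Lemma isometry_adjoint H K (T : {linear H -> K}) : is_isometry T ->
  exists A : {linear K -> H},
    (forall x y, inner (T x) y = inner x (A y)) /\ (forall y, `|A y| <= `|y|).
Proof.
move=> T1; have TA := adjointP (isometry_continuous T1).
have lin : linear (adjoint T).
  move=> a x y; apply: inner_inj => u.
  by rewrite -TA !innerDr !innerZr !TA.
have [A AE] := linear_from lin; exists A.
split=> [x y|y]; first by rewrite AE TA.
have [->|A0] := eqVneq (A y) 0; first by rewrite normr0.
have : `|A y| * `|A y| <= `|A y| * `|y|.
  rewrite -expr2 -inner_norm {2}AE -TA -(T1 (A y)).
  apply: le_trans (cauchy_schwarz _ _); rewrite real_ler_norm //.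
  by rewrite TA -AE inner_norm realX ?normr_real.
by rewrite ler_pM2l // normr_gt0.
Qed.

(** Mutually inverse contractions are isometric, as [|x| = |S (U x)| <= |U x| <= |x|]. Then [inner
    (U x) y = inner (U x) (U (S y)) = inner x (S y)], so the inverse is the adjoint. *)
Lemma unitary_inverse K (U S : {linear K -> K}) :
    (forall x, `|U x| <= `|x|) -> (forall x, `|S x| <= `|x|) ->
    cancel S U -> cancel U S ->
  adjoint U =1 S /\ unitary U.
Proof.
move=> U1 S1 SK UK.
have Uiso : is_isometry U.
  by move=> x; apply/le_anti; rewrite U1 -{1}[x]UK S1.
have Uc := isometry_continuous Uiso.
have aU y : adjoint U y = S y.
  by apply: inner_inj => x; rewrite -adjointP // -{1}[y]SK isometry_inner.
by split=> //; split=> // x; rewrite aU ?UK ?SK.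
Qed.

End Inner.

Lemma real_cvg_unique (R : realType) (u : R^nat) (a b : R) :
  u @ \oo --> a -> u @ \oo --> b -> a = b.
Proof. by move=> ua ub; rewrite -(cvg_lim _ ua) // -(cvg_lim _ ub). Qed.

(** * The Hilbert space of bounded coherent sequences *)

Section InverseLimit.
Variables (R : realType) (H : hilbertType R) (A : {linear H -> H}).

Definition coherent : {pred nat -> H} := fun x =>
  `[< (forall m, A (x m.+1) = x m) /\
      exists M : R, forall m, rnorm (x m) <= M >].

Lemma coherent_submod_closed : submod_closed coherent.
Proof.
split=> [|a x y /asboolP[Ax [M xM]] /asboolP[Ay [N yN]]]; apply/asboolP.
  split=> [m|]; first exact: linear0.
  by exists 0 => m; rewrite [_ m]/(0 : H) rnorm0.
split=> [m|]; first by rewrite [LHS]linearP Ax Ay.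
exists (complex.Re `|a| * M + N) => m.
apply: le_trans (rnormD _ _) (lerD _ (yN m)).
by rewrite rnormZ ler_wpM2l // -lecR RRe_real ?normr_real ?normr_ge0.
Qed.

HB.instance Definition _ :=
  GRing.isSubmodClosed.Build R[i] (nat -> H) coherent coherent_submod_closed.

Hypothesis A_contr : forall x, `|A x| <= `|x|.

(* The contraction proof is a parameter so that instances depending on it can be
   attached to the type. *)
Record invlim (contr : forall x, `|A x| <= `|x|) :=
  InvLim { coords :> nat -> H; _ : coords \in coherent }.

Local Notation K := (invlim A_contr).

HB.instance Definition _ := [isSub for @coords A_contr].
HB.instance Definition _ := [Choice of K by <:].
HB.instance Definition _ := [SubChoice_isSubLmodule of K by <:].

Implicit Types x y : K.

Lemma coordsP x m : A (x m.+1) = x m.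
Proof. by case: x => x /= /asboolP[]. Qed.

Lemma coords_ub x : has_ubound (range (fun m => rnorm (x m))).
Proof.
case: x => x /= /asboolP[_ [M xM]].
by exists M => _ [m _ <-].
Qed.

Lemma coordsD x y m : (x + y) m = x m + y m. Proof. by []. Qed.

Lemma coordsZ (a : R[i]) x m : (a *: x) m = a *: x m. Proof. by []. Qed.

Lemma coordsB x y m : (x - y) m = x m - y m. Proof. by []. Qed.

Lemma invlim_eq x y : (forall m, x m = y m) -> x = y.
Proof. by move=> xy; apply/val_inj/funext. Qed.

Lemma coords_nondecreasing x : nondecreasing_seq (fun m => rnorm (x m)).
Proof.
apply/nondecreasing_seqP => m.
by rewrite -coordsP -lecR -!rnormE.
Qed.

(** Coordinate norms increase because [A] is a contraction, so this supremum is also a limit. The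
    supremum serves for estimates, the limit for identities. *)
Definition limnorm x : R := sup (range (fun m => rnorm (x m))).

Lemma limnorm_cvg x : (fun m => rnorm (x m)) @ \oo --> limnorm x.
Proof.
exact: nondecreasing_cvgn (@coords_nondecreasing x) (@coords_ub x).
Qed.

Lemma rnorm_coords_le x m : rnorm (x m) <= limnorm x.
Proof. by apply: ub_le_sup; [exact: coords_ub|exists m]. Qed.

Lemma limnorm_le x (M : R) : (forall m, rnorm (x m) <= M) -> limnorm x <= M.
Proof.
by move=> xM; apply: ge_sup => [|_ [m _ <-]//]; exists (rnorm (x 0)), 0.
Qed.

Let norm x : R[i] := (limnorm x)%:C%C.

Let normD x y : norm (x + y) <= norm x + norm y.
Proof.
rewrite -rmorphD lecR; apply: limnorm_le => m; rewrite coordsD.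
by rewrite (le_trans (rnormD _ _)) // lerD // rnorm_coords_le.
Qed.

Let normZ (a : R[i]) x : norm (a *: x) = `|a| * norm x.
Proof.
rewrite -(RRe_real (normr_real a)) -rmorphM; congr (_%:C%C).
apply: real_cvg_unique (@limnorm_cvg _) _.
under eq_fun do rewrite coordsZ rnormZ.
exact: cvgMr (@limnorm_cvg x).
Qed.

Let norm0 x : norm x = 0 -> x = 0.
Proof.
move=> [x0]; apply: invlim_eq => m; apply/eqP; rewrite -normr_eq0 rnormE.
rewrite (_ : rnorm _ = 0) //; apply/le_anti; rewrite rnorm_ge0 andbT.
by rewrite (le_trans (rnorm_coords_le x m)) // x0.
Qed.

HB.instance Definition _ :=
  @Lmodule_isNormed.Build R[i] K norm normD normZ norm0.

Lemma ball_rnorm (W : normedModType R[i]) (c u : W) (e : R) :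
  ball c e%:C%C u <-> rnorm (c - u) < e.
Proof. by rewrite -ball_normE /= rnormE ltcR. Qed.

(** Coordinate maps are contractions, so a Cauchy filter converges in each coordinate. The limit
    sequence is coherent by continuity of [A], and the estimate [lc] is uniform in the coordinate,
    which gives convergence in the supremum norm. *)
Let complete (F : set_system K) : ProperFilter F -> cauchy F -> cvg F.
Proof.
move=> PF /cauchyP Fc.
have Fball (e : R) : 0 < e -> exists c : K, F [set x | rnorm (c - x) < e].
  move=> e0; have [|c Fce] := Fc e%:C%C; first by rewrite ltcR.
  by exists c; apply: filterS Fce => x /ball_rnorm.
have posE (e : R[i]) : 0 < e -> exists2 d : R, 0 < d & e = d%:C%C.
  move=> e0; exists (complex.Re e); first by move: e0; rewrite ltcE => /andP[].
  by rewrite RRe_real ?gtr0_real.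
have coords_le (c x : K) m : rnorm (c m - x m) <= rnorm (c - x).
  by rewrite -coordsB rnorm_coords_le.
have /choice[l lP] : forall m, exists l : H, (fun x : K => x m) @ F --> l.
  move=> m; apply/cvg_ex/cauchy_cvgP/cauchy_exP => _ /posE[e e0 ->].
  have [c Fce] := Fball e e0; exists (c m).
  apply: (@filterS _ F _ _ _ _ Fce) => x /= cx; apply/ball_rnorm.
  exact: le_lt_trans (coords_le _ _ _) cx.
have lF m (d : R) : 0 < d -> F [set x : K | rnorm (l m - x m) < d].
  move=> d0; have dC : 0 < d%:C%C :> R[i] by rewrite ltcR.
  have := lP m _ (nbhsx_ballx (l m) (d%:C%C) dC).
  by apply: (@filterS _ F) => x /ball_rnorm.
have lc (c : K) e m : F [set x | rnorm (c - x) < e] -> rnorm (l m - c m) <= e.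
  move=> Fce; apply/ler_addgt0Pr => d d0.
  have [x [/= xc xl]] := filter_ex (filterI Fce (lF m d d0)).
  rewrite -(subrKA (x m)) (le_trans (rnormD _ _)) // addrC lerD ?(ltW xl) //.
  rewrite -opprB /rnorm normrN -/(rnorm _).
  exact: le_trans (coords_le _ _ _) (ltW xc).
have lS : l \in coherent.
  apply/asboolP; split=> [m|].
    apply: (cvg_unique (@norm_hausdorff _ H) _ (lP m)).
    rewrite (_ : (fun x : K => x m) = (fun x : K => A (x m.+1))); last first.
      by apply/funext => x; rewrite coordsP.
    apply: continuous_cvg (lP m.+1).
    exact: contraction_continuous.
  have [c /lc cl] := Fball 1 ltr01; exists (1 + limnorm c) => m.
  rewrite -[l m](subrK (c m)) (le_trans (rnormD _ _)) // lerD //.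
  exact: rnorm_coords_le.
apply/cvg_ex; exists (InvLim A_contr lS); apply/cvg_ballP => _ /posE[e e0 ->].
have [c Fce] := Fball (e / 2) ltac:(by rewrite divr_gt0).
have cl : rnorm (InvLim A_contr lS - c) <= e / 2.
  by apply: limnorm_le => m; exact: lc.
apply: filterS Fce => x /= cx; apply/ball_rnorm.
rewrite -(subrKA c) (le_lt_trans (rnormD _ _)) //.
by rewrite [e]splitr ler_ltD.
Qed.

HB.instance Definition _ := Uniform_isComplete.Build K complete.

(** The limit of the coordinatewise inner products, taken separately on real and imaginary parts so
    that real polarization proves its existence. *)
Definition liminner x y : R[i] :=
  (lim ((fun m => complex.Re (inner (x m) (y m))) @ \oo) +i*
   lim ((fun m => complex.Im (inner (x m) (y m))) @ \oo))%C.

Lemma Re_inner_cvg x y :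
  (fun m => complex.Re (inner (x m) (y m))) @ \oo --> complex.Re (liminner x y).
Proof.
suff : cvg ((fun m => complex.Re (inner (x m) (y m))) @ \oo) by [].
apply/cvg_ex.
exists (2^-1 * (limnorm (x + y) ^+ 2 - limnorm x ^+ 2 - limnorm y ^+ 2)).
under eq_fun do rewrite Re_inner_polar -coordsD.
apply: cvgMr; apply: cvgB; [apply: cvgB|]; rewrite expr2;
  under eq_fun do rewrite expr2; apply: cvgM; exact: limnorm_cvg.
Qed.

Lemma Im_inner_cvg x y :
  (fun m => complex.Im (inner (x m) (y m))) @ \oo --> complex.Im (liminner x y).
Proof.
suff : cvg ((fun m => complex.Im (inner (x m) (y m))) @ \oo) by [].
under eq_fun do rewrite Im_inner -coordsZ.
by apply/cvg_ex; eexists; exact: Re_inner_cvg.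
Qed.

Let liminnerP (a : R[i]) x y z :
  liminner (a *: x + y) z = a * liminner x z + liminner y z.
Proof.
case: a => a b.
have [Rx Ix] := (@Re_inner_cvg x z, @Im_inner_cvg x z).
have [Ry Iy] := (@Re_inner_cvg y z, @Im_inner_cvg y z).
apply/eqP; rewrite eq_complex; apply/andP; split; apply/eqP.
  apply: real_cvg_unique (@Re_inner_cvg _ _) _.
  have -> : complex.Re ((a +i* b)%C * liminner x z + liminner y z) =
      a * complex.Re (liminner x z) - b * complex.Im (liminner x z)
      + complex.Re (liminner y z) by case: liminner; case: liminner.
  rewrite (_ : (fun m => _) = fun m =>
      a * complex.Re (inner (x m) (z m)) - b * complex.Im (inner (x m) (z m))
      + complex.Re (inner (y m) (z m))); last first.
    by apply/funext => m; rewrite innerP; case: inner; case: inner.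
  by apply: cvgD => //; apply: cvgB; exact: cvgMr.
apply: real_cvg_unique (@Im_inner_cvg _ _) _.
have -> : complex.Im ((a +i* b)%C * liminner x z + liminner y z) =
    a * complex.Im (liminner x z) + b * complex.Re (liminner x z)
    + complex.Im (liminner y z) by case: liminner; case: liminner.
rewrite (_ : (fun m => _) = fun m =>
    a * complex.Im (inner (x m) (z m)) + b * complex.Re (inner (x m) (z m))
    + complex.Im (inner (y m) (z m))); last first.
  by apply/funext => m; rewrite innerP; case: inner; case: inner.
by apply: cvgD => //; apply: cvgD; exact: cvgMr.
Qed.

Let liminnerC x y : liminner y x = (liminner x y)^*.
Proof.
apply/eqP; rewrite eq_complex; apply/andP; split; apply/eqP.
  apply: real_cvg_unique (@Re_inner_cvg _ _) _.
  rewrite (_ : (fun m => _) = fun m => complex.Re (inner (x m) (y m))).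
    by have := @Re_inner_cvg x y; case: liminner.
  by apply/funext => m; rewrite innerC; case: inner.
apply: real_cvg_unique (@Im_inner_cvg _ _) _.
rewrite (_ : (fun m => _) = fun m => - complex.Im (inner (x m) (y m))).
  have -> : complex.Im (liminner x y)^* = - complex.Im (liminner x y).
    by case: liminner.
  exact: cvgN (@Im_inner_cvg x y).
by apply/funext => m; rewrite innerC; case: inner.
Qed.

Let liminner_norm x : liminner x x = `|x| ^+ 2.
Proof.
rewrite rnormE -rmorphXn; apply/eqP; rewrite eq_complex; apply/andP.
split; apply/eqP.
  apply: real_cvg_unique (@Re_inner_cvg _ _) _.
  under eq_fun do rewrite Re_inner_diag expr2.
  by rewrite /= expr2; apply: cvgM; exact: limnorm_cvg.
apply: real_cvg_unique (@Im_inner_cvg _ _) _.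
rewrite (_ : (fun m => _) = fun=> 0); first exact: cvg_cst.
by apply/funext => m; rewrite inner_norm rnormE -rmorphXn.
Qed.

HB.instance Definition _ := CompleteNormedModule_isHilbert.Build R K
  liminnerP liminnerC liminner_norm.

End InverseLimit.

(** * Operators on the inverse limit and the embedding of [H] *)

Section InverseLimitMaps.
Variables (R : realType) (H : hilbertType R) (A : {linear H -> H}).
Hypothesis A_contr : forall x, `|A x| <= `|x|.
Local Notation K := (invlim A_contr).

(** The last hypothesis is what coherence of the image requires: the weights [d] absorb the scalar
    by which [B] fails to commute with [A]. The shift [k] is 0 for the adjoints of the extensions
    and 1 for the extensions. *)
Lemma invlim_map (B : {linear H -> H}) (d : nat -> R[i]) (k : nat) :
    (forall h, `|B h| <= `|h|) -> (forall m, `|d m| = 1) ->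
    (forall m h, d m.+1 *: A (B h) = d m *: B (A h)) ->
  exists S : {linear K -> K},
    (forall x m, S x m = d m *: B (x (m + k)%N)) /\ (forall x, `|S x| <= `|x|).
Proof.
move=> B1 d1 AB.
have le (x : K) m : rnorm (d m *: B (x (m + k)%N)) <= limnorm x.
  rewrite rnormZ d1 mul1r (le_trans _ (rnorm_coords_le x (m + k))) //.
  by rewrite -lecR -!rnormE.
have mem (x : K) : (fun m => d m *: B (x (m + k)%N)) \in coherent A.
  apply/asboolP; split=> [m|]; last by exists (limnorm x).
  by rewrite linearZ /= AB addSn coordsP.
have lin : linear (fun x => InvLim A_contr (mem x)).
  move=> a x y; apply: invlim_eq => m.
  rewrite coordsD coordsZ /=.
  rewrite [LHS](_ : _ = d m *: B (a *: x (m + k)%N + y (m + k)%N)) //.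
  by rewrite linearP scalerDr !scalerA mulrC.
have [S SE] := linear_from lin; exists S; split=> [x m|x]; rewrite SE //.
by rewrite !rnormE lecR; apply: limnorm_le => m; exact: le.
Qed.

(** Forward orbits of [T] are coherent because [A] undoes [T], and their coordinate norms are
    constant. *)
Lemma invlim_embedding (T : {linear H -> H}) :
    is_isometry T -> cancel T A ->
  exists iota : {linear H -> K},
    (forall h m, iota h m = iter m T h) /\ is_isometry iota.
Proof.
move=> T1 TK.
have T1' m h : rnorm (iter m T h) = rnorm h.
  by elim: m => //= m IH; rewrite /rnorm T1.
have mem h : (fun m => iter m T h) \in coherent A.
  apply/asboolP; split=> [m /=|]; first exact: TK.
  by exists (rnorm h) => m; rewrite T1'.
have lin : linear (fun h => InvLim A_contr (mem h)).
  move=> a x y; apply: invlim_eq => m; rewrite coordsD coordsZ /=.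
  by elim: m => //= m ->; rewrite linearP.
have [iota iotaE] := linear_from lin; exists iota.
split=> [h m|h]; rewrite iotaE // !rnormE; congr (_%:C%C).
apply/le_anti/andP; split; first by apply: limnorm_le => m; rewrite /= T1'.
exact: rnorm_coords_le (InvLim A_contr (mem h)) 0%N.
Qed.

End InverseLimitMaps.

(** * The product of the isometries and its left factors *)

Section Product.
Variables (R : realType) (n : nat) (z : 'I_n -> 'I_n -> R[i]).
Variables (H : hilbertType R) (V : 'I_n -> {linear H -> H}).
Hypothesis z_norm : forall i j, `|z i j| = 1.
Hypothesis z_diag : forall i, z i i = 1.
Hypothesis V_isometry : forall i, is_isometry (V i).
Hypothesis V_comm :
  forall i j, i != j -> forall h, V j (V i h) = z j i *: V i (V j h).

Lemma scaled_isometry (c : R[i]) (T : {linear H -> H}) :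
  `|c| = 1 -> is_isometry T ->
  exists2 S : {linear H -> H}, is_isometry S & forall h, S h = c *: T h.
Proof.
move=> c1 T1; have [|S SE] := @linear_from R H H (fun h => c *: T h).
  by move=> a x y; rewrite linearP scalerDr !scalerA mulrC.
by exists S => // h; rewrite SE normrZ c1 mul1r T1.
Qed.

Lemma comp_isometry (S T : {linear H -> H}) : is_isometry S -> is_isometry T ->
  exists2 U : {linear H -> H}, is_isometry U & forall h, U h = S (T h).
Proof.
move=> S1 T1; have [|U UE] := @linear_from R H H (fun h => S (T h)).
  by move=> a x y; rewrite !linearP.
by exists U => // h; rewrite UE S1 T1.
Qed.

(** Induction on the list, composing the product with the new isometry on the right. *)
Lemma twisted_product (s : seq 'I_n) :
  exists2 T : {linear H -> H}, is_isometry T &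
    (forall j, exists2 c, `|c| = 1 & forall h, V j (T h) = c *: T (V j h)) /\
    (forall j, j \in s -> exists2 Q : {linear H -> H},
      is_isometry Q & forall h, T h = V j (Q h)).
Proof.
elim: s => [|k s [T T1 [Tc Ts]]].
  exists idfun => //; split=> // j; exists 1; first exact: normr1.
  by move=> h; rewrite scale1r.
have [S S1 SE] := comp_isometry T1 (V_isometry k); exists S => //.
split=> [j|j].
  (* One scalar covers both cases, since [z k k = 1] when [j = k]. *)
  have [c c1 cT] := Tc j; exists (c * z j k).
    by rewrite normrM c1 z_norm mul1r.
  move=> h; rewrite !SE cT -scalerA -[z j k *: _]linearZ /=.
  have [->|kj] := eqVneq k j; first by rewrite z_diag scale1r.
  by rewrite V_comm.
(* The new factor [V k] is moved to the left of [T] at the cost of [c^-1]; an older factor is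
   already on the left. *)
rewrite in_cons; case: eqP => [-> _|_ /= /Ts[Q Q1 QE]].
  have [c c1 cT] := Tc k.
  have [|Q Q1 QE] := @scaled_isometry c^-1 T _ T1.
    by rewrite normfV c1 invr1.
  exists Q => // h; rewrite SE QE linearZ /= cT scalerA mulVf ?scale1r //.
  by rewrite -normr_eq0 c1 oner_eq0.
have [Q' Q'1 Q'E] := comp_isometry Q1 (V_isometry k).
by exists Q' => // h; rewrite SE QE Q'E.
Qed.

End Product.

Lemma conjC_unit (R : realType) (c : R[i]) : `|c| = 1 -> c^* = c^-1.
Proof.
move=> c1; have c0 : c != 0 by rewrite -normr_eq0 c1 oner_eq0.
by apply: (mulfI c0); rewrite -normCK c1 expr1n divff.
Qed.

Lemma isometry_inj (R : realType) (H K : hilbertType R) (T : {linear H -> K}) :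
  is_isometry T -> injective T.
Proof.
move=> T1 x y /eqP; rewrite -subr_eq0 -linearB -normr_eq0 T1 normr_eq0 subr_eq0.
by move/eqP.
Qed.

(** * Extending one factor of [T] to an invertible operator *)

Section FactorExtension.
Variables (R : realType) (H : hilbertType R) (T A : {linear H -> H}).
Hypothesis TA : forall x y, inner (T x) y = inner x (A y).
Hypothesis A_contr : forall x, `|A x| <= `|x|.
Local Notation K := (invlim A_contr).

(** With [B] and [C] the adjoints of [V] and [Q], both [B C] and [C B] are multiples of [A], and [A]
    acts on coherent sequences as an index shift. Weighted coordinatewise copies of [B] and [C] are
    therefore mutually inverse. *)
Lemma factor_extension (V Q : {linear H -> H}) (c : R[i])
    (iota : {linear H -> K}) :
    is_isometry V -> is_isometry Q -> `|c| = 1 ->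
    (forall h, T h = V (Q h)) -> (forall h, V (T h) = c *: T (V h)) ->
    (forall h m, iota h m = iter m T h) ->
  exists U S : {linear K -> K},
    [/\ forall x, `|U x| <= `|x|, forall x, `|S x| <= `|x|,
        cancel U S, cancel S U & (forall h, U (iota h) = iota (V h)) /\
      exists2 B : H -> H, (forall x y, inner (V x) y = inner x (B y)) &
        forall x m, S x m = c ^+ m *: B (x m)].
Proof.
move=> V1 Q1 c1 TVQ VT iotaE.
have [B [VB B1]] := isometry_adjoint V1.
have [C [QC C1]] := isometry_adjoint Q1.
have c0 : c != 0 by rewrite -normr_eq0 c1 oner_eq0.
have cC := conjC_unit c1.
have QV h : Q (V h) = c^-1 *: T h.
  apply: (isometry_inj V1); rewrite -TVQ linearZ /= VT scalerA mulVf //.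
  by rewrite scale1r.
have TQ h : T (Q h) = c *: Q (T h).
  by apply: (isometry_inj V1); rewrite VT linearZ /= -!TVQ.
(* These identities are the adjoints of the relations among [T], [V] and [Q]; conjugation inverts
   the unit scalar [c]. *)
have AB h : A (B h) = c^-1 *: B (A h).
  apply: inner_inj => x.
  by rewrite innerZr -TA -!VB -TA VT innerZl -cC conjCK.
have CA h : C (A h) = c^-1 *: A (C h).
  by apply: inner_inj => x; rewrite innerZr -QC -!TA -QC TQ innerZl -cC conjCK.
have BC h : B (C h) = c *: A h.
  apply: inner_inj => x.
  by rewrite innerZr -VB -QC -TA QV innerZl cC.
have CB h : C (B h) = A h.
  by apply: inner_inj => x; rewrite -QC -VB -TA TVQ.
have CQ : cancel Q C.
  by move=> h; apply: inner_inj => x; rewrite -QC isometry_inner.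
have VTm m h : V (iter m T h) = c ^+ m *: iter m T (V h).
  elim: m => [|m IH] /=; first by rewrite scale1r.
  by rewrite VT IH linearZ /= scalerA exprS.
have [|m h|S [SE S1]] := @invlim_map _ _ _ A_contr B (fun m => c ^+ m) 0 B1.
- by move=> m; rewrite normrX c1 expr1n.
- by rewrite AB scalerA exprSr mulfK.
(* The exponent [m.+1] compensates the extra [c] in [B (C h) = c *: A h], and the shift by 1 is
   undone by [A]. *)
have [|m h|U [UE U1]] :=
  @invlim_map _ _ _ A_contr C (fun m => c^-1 ^+ m.+1) 1 C1.
- by move=> m; rewrite normrX normfV c1 invr1 expr1n.
- by rewrite /= CA scalerA -exprSr.
exists U, S; split=> //.
- move=> x; apply: invlim_eq => m.
  rewrite SE UE addn0 linearZ /= BC !scalerA exprSr mulrA -exprMn divff //.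
  by rewrite expr1n mul1r mulVf // scale1r addn1 coordsP.
- move=> x; apply: invlim_eq => m.
  rewrite UE SE addn0 addn1 linearZ /= CB scalerA -exprMn mulVf //.
  by rewrite expr1n scale1r coordsP.
split=> [h|]; last by exists B => // x m; rewrite SE addn0.
apply: invlim_eq => m; rewrite UE !iotaE addn1 iterS.
(* Exposes a leading [Q] for [C] to cancel; the remaining [V] then passes through the iterates of
   [T], giving [c ^+ m]. *)
have -> y : T y = c *: Q (V y) by rewrite QV scalerA divff // scale1r.
rewrite linearZ /= CQ VTm !scalerA -mulrA -exprS -exprMn mulVf //.
by rewrite expr1n scale1r.
Qed.

End FactorExtension.

(** * Simultaneous extension and the twisted relations *)

Theorem corollary8p10 (R : realType) (n : nat) (z : 'I_n -> 'I_n -> R[i])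
    (H : hilbertType R) (V : 'I_n -> {linear H -> H})
    (z_norm : forall i j, `|z i j| = 1)
    (z_inv : forall i j, z i j * z j i = 1)
    (z_diag : forall i, z i i = 1)
    (V_isometry : forall i, is_isometry (V i))
    (V_rel : twisted_relations z V) :
  exists (K : hilbertType R) (iota : {linear H -> K})
      (U : 'I_n -> {linear K -> K}),
    unitary_extension z V iota U.
Proof.
have V_comm i j : i != j -> forall h, V j (V i h) = z j i *: V i (V j h).
  by case/V_rel.
have [T T1 [Tc TV]] :=
  twisted_product z_norm z_diag V_isometry V_comm (enum 'I_n).
have [A [TA A1]] := isometry_adjoint T1.
have TK : cancel T A.
  by move=> h; apply: inner_inj => x; rewrite -TA isometry_inner.
have [iota [iotaE iota1]] := invlim_embedding A1 T1 TK.
have /choice[c cP] : forall j, exists c,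
    `|c| = 1 /\ forall h, V j (T h) = c *: T (V j h).
  by move=> j; have [c] := Tc j; exists c.
have /choice[U /choice[S US]] j : exists U S : {linear invlim A1 -> invlim A1},
    [/\ forall x, `|U x| <= `|x|, forall x, `|S x| <= `|x|,
        cancel U S, cancel S U & (forall h, U (iota h) = iota (V j h)) /\
      exists2 B : H -> H, (forall x y, inner (V j x) y = inner x (B y)) &
        forall x m, S x m = c j ^+ m *: B (x m)].
  have [Q Q1 QE] := TV j (mem_enum _ j); have [c1 cT] := cP j.
  exact: (factor_extension TA (V_isometry j) Q1 c1 QE cT iotaE).
have zC i j : (z i j)^* = z j i.
  by apply: (mulfI (_ : z i j != 0)); rewrite ?z_inv -?normCK ?z_norm ?expr1n //
    -normr_eq0 z_norm oner_eq0.
(* The relation is proved first for the inverses [S], where it is coordinatewise the adjoint of the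
   relation for [V], and then inverted. *)
have U_comm i j : i != j -> forall x, U j (U i x) = z j i *: U i (U j x).
  move=> ij x; have [_ _ UKi SKi [_ [Bi VBi SEi]]] := US i.
  have [_ _ UKj SKj [_ [Bj VBj SEj]]] := US j.
  have BB h : Bi (Bj h) = z i j *: Bj (Bi h).
    apply: inner_inj => y.
    by rewrite innerZr -VBi -!VBj -VBi V_comm // innerZl zC.
  (* [B] is only known as a function here; its homogeneity is recovered from the adjoint
     identity. *)
  have BZ (k : 'I_n) (B : H -> H) a h :
      (forall x y, inner (V k x) y = inner x (B y)) -> B (a *: h) = a *: B h.
    by move=> VB; apply: inner_inj => y; rewrite innerZr -!VB innerZr.
  have SS y : S i (S j y) = z i j *: S j (S i y).
    apply: invlim_eq => m.
    rewrite coordsZ SEi !SEj SEi (BZ i Bi _ _ VBi) (BZ j Bj _ _ VBj) BB.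
    rewrite !scalerA; congr (_ *: _).
    by rewrite -mulrA mulrC -mulrA [RHS]mulrA [z i j * _]mulrC.
  (* Applying [U j] after [U i] to both sides of this equation gives the claim. *)
  have e : S i (S j (z j i *: U i (U j x))) = x.
    by rewrite SS !linearZ /= UKi UKj scalerA z_inv scale1r.
  by rewrite -[in LHS]e SKi SKj.
have unitaryU i : adjoint (U i) =1 S i /\ unitary (U i).
  by have [U1 S1 UK SK _] := US i; exact: unitary_inverse.
exists (invlim A1), iota, U; split=> // [i|i h|i j ij].
- by have [] := unitaryU i.
- by have [_ _ _ _ []] := US i.
split=> x; first exact: U_comm.
have [aU _] := unitaryU i; have [_ _ UKi SKi _] := US i.
(* Writing [x] as [U i (S i x)] lets [U j] pass [U i], which [S i] then cancels. *)
by rewrite !aU -[in LHS](SKi x) U_comm // linearZ /= UKi zC.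
Qed.
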